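(* Let $q$ be real with $|q|<1$. (i) For all integers $n\ge1$ and all complex $y$, $$0=\sum_{j=0}^n\begin{bmatrix}n\\ j\end{bmatrix}_qh_j(y|q)\,b_{n-j}(y|q).$$ (ii) For real $\rho,x,y$ with $|\rho|<1$, $|x|\le1$, $|y|\le1$, $$\frac{(\rho^2)_\infty}{\prod_{j=0}^\infty w(x,y|\rho q^j)}=\sum_{j\ge0}\frac{\rho^j}{(q)_j}h_j(x|q)h_j(y|q),$$ $$\frac{\prod_{j=0}^\infty w(x,y|\rho q^j)}{(\rho^2)_\infty}=\sum_{j\ge0}\frac{\rho^j}{(q)_j(\rho^2)_j}\,b_j(y|q)\,p_j(x|y,\rho,q).$$
   Context: $(a)_n=\prod_{j=0}^{n-1}(1-aq^j)$, $(a)_\infty=\prod_{j\ge0}(1-aq^j)$, $\begin{bmatrix}n\\ k\end{bmatrix}_q=\frac{(q)_n}{(q)_k(q)_{n-k}}$, and $$w(x,y|a)=(1-a^2)^2-4xya(1+a^2)+4a^2(x^2+y^2).$$ $h_n(x|q)$ are the continuous $q$-Hermite polynomials: $h_0=1$, $h_1(x|q)=2x$, $h_n(x|q)=2xh_{n-1}(x|q)-(1-q^{n-1})h_{n-2}(x|q)$. The auxiliary polynomials are $b_n(x|q)=(-1)^nq^{\binom n2}h_n(x|q^{-1})$ for $q\ne0$, and $b_0(x|0)=b_2(x|0)=1$, $b_1(x|0)=-2x$, $b_n(x|0)=0$ for $n\ge3$. $p_n(x|y,\rho,q)$ are the Al-Salam–Chihara polynomials $Q_n(x|a,b,q)$ with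 $a+b=2\rho y$, $ab=\rho^2$: $p_{-1}=0$, $p_0=1$, $p_{n+1}(x|y,\rho,q)=2(x-\rho yq^n)p_n(x|y,\rho,q)-(1-\rho^2q^{n-1})(1-q^n)p_{n-1}(x|y,\rho,q)$. *)

(* Defs.v *)
From HB Require Import structures.
From mathcomp Require Import all_boot all_order all_algebra.
From mathcomp Require Import complex.
From mathcomp Require Import all_classical all_reals all_analysis.
Set Implicit Arguments.
Unset Strict Implicit.
Unset Printing Implicit Defensive.
Import Order.TTheory GRing.Theory Num.Theory.
Import numFieldNormedType.Exports.
Local Open Scope ring_scope.

(* The polynomials below are represented by their values at a point of an     *)
(* arbitrary field, so that the same definitions serve for real and complex   *)
(* arguments.                                                                 *)
Section QPolynomials.
Variable F : fieldType.
Implicit Types (a q x y rho : F) (n k : nat).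

Definition qpoch a q n : F := \prod_(j < n) (1 - a * q ^+ j).

Definition qbinom q n k : F := qpoch q q n / (qpoch q q k * qpoch q q (n - k)).

Definition wfun x y a : F :=
  (1 - a ^+ 2) ^+ 2 - 4 * x * y * a * (1 + a ^+ 2)
  + 4 * a ^+ 2 * (x ^+ 2 + y ^+ 2).

(* Continuous q-Hermite polynomials h_n(x|q); |q| > 1 is needed for bpol.     *)
Fixpoint qHermite x q n : F :=
  match n with
  | 0 => 1
  | n1.+1 =>
    match n1 with
    | 0 => 2 * x
    | n2.+1 => 2 * x * qHermite x q n1 - (1 - q ^+ n1) * qHermite x q n2
    end
  end.

(* b_n(x|q): the polynomials h_n(x|1/q) rescaled so as to extend to q = 0.    *)
Definition bpol x q n : F :=
  if q == 0 then
    match n with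
    | 0 => 1
    | 1 => - (2 * x)
    | 2 => 1
    | _ => 0
    end
  else (-1) ^+ n * q ^+ 'C(n, 2) * qHermite x q^-1 n.

(* Al-Salam--Chihara polynomials p_n(x|y,rho,q) = Q_n(x|a,b,q) with           *)
(* a + b = 2 rho y and a b = rho^2. Since p_{-1} = 0, the first step of the   *)
(* recurrence is p_1 = 2 (x - rho y).                                         *)
Fixpoint pASC x y rho q n : F :=
  match n with
  | 0 => 1
  | n1.+1 =>
    match n1 with
    | 0 => 2 * (x - rho * y)
    | n2.+1 =>
      2 * (x - rho * y * q ^+ n1) * pASC x y rho q n1
      - (1 - rho ^+ 2 * q ^+ n2) * (1 - q ^+ n1) * pASC x y rho q n2
    end
  end.

End QPolynomials.

Section InfiniteProducts.
Variable R : realType.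
Implicit Types a q x y rho : R.

(* For |q| < 1 both sequences of partial products converge, so limn is never  *)
(* used at its default value. If moreover |rho| < 1, |x| <= 1 and       *)
(* |y| <= 1, then wprod_inf x y rho q and qpoch_inf (rho ^+ 2) q are nonzero. *)
Definition qpoch_inf a q : R := limn (fun n => qpoch a q n).

Definition wprod_inf x y rho q : R :=
  limn (fun n => \prod_(j < n) wfun x y (rho * q ^+ j)).

End InfiniteProducts.

(* Main.v *)
Require Import Defs.
From HB Require Import structures.
From mathcomp Require Import all_boot all_order all_algebra.
From mathcomp Require Import complex ring lra zify.
From mathcomp Require Import all_classical all_reals all_analysis.
Set Implicit Arguments.
Unset Strict Implicit.
Unset Printing Implicit Defensive.
Import Order.TTheory GRing.Theory Num.Theory.
Import numFieldNormedType.Exports.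
Local Open Scope classical_set_scope.
Local Open Scope ring_scope.

(* Part (i): the generating functions of h_n and b_n, with coefficients divided
   by (q)_n, satisfy (1 - 2yt + t^2) phi(t) = phi(qt) and
   psi(t) = (1 - 2yt + t^2) psi(qt), so phi psi is invariant under t -> qt.

   Part (ii): F(t) = sum_n h_n(x) h_n(y) t^n / (q)_n satisfies
   w(x,y|t) F(t) = (1 - t^2)(1 - q t^2) F(qt); iterating, and using F(0) = 1,
   gives F(rho) = (rho^2)_oo / prod_j w(x,y|rho q^j), convergence of the products
   included. The sums A_m = sum_i rho^i h_i(y) h_{i+m}(x) / (q)_i satisfy a
   three-term recurrence in m, whence A_m = F(rho) p_m / (rho^2)_m (Carlitz).
   So F(rho) times the second series is sum_j rho^j b_j(y) A_j / (q)_j; summing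
   this double series along the diagonals i + j = n, part (i) kills every term
   but n = 0. All rearrangements are justified by the subexponential growth of
   h_n, b_n and 1/(q)_n. *)

Arguments qHermite : simpl never.
Arguments pASC : simpl never.

(** * Recurrences, Cauchy products and part (i), over an arbitrary field *)

Section Algebra.
Variable F : fieldType.
Implicit Types (q x y : F) (u v : nat -> F) (n : nat).

Lemma qpochS (a q : F) n : qpoch a q n.+1 = qpoch a q n * (1 - a * q ^+ n).
Proof. by rewrite /qpoch big_ord_recr. Qed.

Lemma qpoch0 (a q : F) : qpoch a q 0 = 1.
Proof. by rewrite /qpoch big_ord0. Qed.

Lemma qHermite0 x q : qHermite x q 0 = 1.
Proof. by []. Qed.

Lemma qHermite1 x q : qHermite x q 1 = 2 * x.
Proof. by []. Qed.

Lemma qHermiteS x q n : qHermite x q n.+2 =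
  2 * x * qHermite x q n.+1 - (1 - q ^+ n.+1) * qHermite x q n.
Proof. by []. Qed.

Lemma pASCS x y rho q n : pASC x y rho q n.+2 =
  2 * (x - rho * y * q ^+ n.+1) * pASC x y rho q n.+1
  - (1 - rho ^+ 2 * q ^+ n) * (1 - q ^+ n.+1) * pASC x y rho q n.
Proof. by []. Qed.

Lemma bpol0 x q : bpol x q 0 = 1.
Proof. by rewrite /bpol; case: ifP => //=; rewrite qHermite0 !mulr1. Qed.

Lemma bpol1 x q : bpol x q 1 = - (2 * x).
Proof.
rewrite /bpol; case: ifP => //= _.
by rewrite qHermite1 expr0 expr1 mulr1 mulN1r.
Qed.

Lemma bpolS x q n : bpol x q n.+2 =
  - (2 * x * q ^+ n.+1) * bpol x q n.+1 + q ^+ n * (1 - q ^+ n.+1) * bpol x q n.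
Proof.
rewrite /bpol; have [->|q0] := eqVneq q 0.
  case: n => [|[|n]]; rewrite ?expr0 !exprS ?mul0r; ring.
rewrite qHermiteS exprVn !binS !bin1 !exprD !bin0 !exprS.
by field; rewrite expf_neq0.
Qed.

(** Multiplication by t, read on coefficient sequences. *)
Definition delay u n : F := if n is m.+1 then u m else 0.

Definition convol u v n : F := \sum_(j < n.+1) u j * v (n - j)%N.

Lemma convol_delayl u v : convol (delay u) v = delay (convol u v).
Proof.
apply/funext => -[|n]; rewrite /convol; first by rewrite big_ord1 mul0r.
by rewrite big_ord_recl mul0r add0r.
Qed.

Lemma convol_scale u v n q :
  convol (fun j => q ^+ j * u j) (fun j => q ^+ j * v j) n = q ^+ n * convol u v n.
Proof.
rewrite /convol mulr_sumr; apply: eq_bigr => j _.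
rewrite -[in q ^+ n](@subnKC j n) -1?ltnS // exprD; ring.
Qed.

Lemma convol_linl (u1 u2 v : nat -> F) (a b : F) n :
  convol (fun j => a * u1 j + b * u2 j) v n = a * convol u1 v n + b * convol u2 v n.
Proof.
rewrite /convol !mulr_sumr -big_split /=; apply: eq_bigr => j _; ring.
Qed.

Lemma convolC u v : convol u v = convol v u.
Proof.
apply/funext => n; rewrite /convol (reindex_inj rev_ord_inj) /=.
by apply: eq_bigr => j _; rewrite subSS subKn 1?mulrC // -ltnS.
Qed.

Section NotRootOfUnity.
Variable q : F.
Hypothesis q_neq1 : forall k, 1 - q ^+ k.+1 != 0.

Lemma qpoch_neq0 n : qpoch q q n != 0.
Proof.
elim: n => [|n IH]; first by rewrite qpoch0 oner_neq0.
by rewrite qpochS mulf_neq0 // -exprS.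
Qed.

(** Coefficient form of phi(t) - phi(qt) = (2xt - t^2) phi(t). *)
Lemma hermite_coef_rec x n (u := fun n => qHermite x q n / qpoch q q n) :
  (1 - q ^+ n) * u n = 2 * x * delay u n + -1 * delay (delay u) n.
Proof.
rewrite /u; case: n => [|[|n]] /=.
- by rewrite subrr mul0r !mulr0 addr0.
- rewrite qHermite1 qHermite0 !qpochS !qpoch0 -exprS mulr0 addr0 !mul1r.
  by have := q_neq1 0; rewrite expr1 => h; field; rewrite oner_neq0.
rewrite qHermiteS !qpochS -!exprS.
have h1 := q_neq1 n.+1; have h2 := q_neq1 n; have h3 := qpoch_neq0 n.
by field; rewrite h1 h2 h3.
Qed.

(** Coefficient form of psi(t) - psi(qt) = (-2xt + t^2) psi(qt); [w] holds the coefficients of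
    psi(qt). *)
Lemma bpol_coef_rec x n (v := fun n => bpol x q n / qpoch q q n)
    (w := fun n => q ^+ n * v n) :
  (1 - q ^+ n) * v n = - (2 * x) * delay w n + delay (delay w) n.
Proof.
rewrite /w /v; case: n => [|[|n]] /=.
- by rewrite subrr mul0r !mulr0 addr0.
- rewrite !qpochS !qpoch0 -exprS addr0 !mul1r.
  rewrite bpol0 bpol1.
  by have := q_neq1 0; rewrite expr1 => h; field; rewrite ?oner_neq0.
rewrite bpolS !qpochS -!exprS.
have h1 := q_neq1 n.+1; have h2 := q_neq1 n; have h3 := qpoch_neq0 n.
by field; rewrite h1 h2 h3.
Qed.

Lemma convol_hermite_bpol y n :
  convol (fun n => qHermite y q n / qpoch q q n)
       (fun n => bpol y q n / qpoch q q n) n = (n == 0)%:R.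
Proof.
set u := fun n => _ ; set v := fun n => _.
(* With G = phi psi and D(t) = G(t) - G(qt), this says D(t) = (2yt - t^2) D(t), which forces D = 0
   coefficient by coefficient. *)
have rec m : (1 - q ^+ m) * convol u v m =
   2 * y * delay (fun k => (1 - q ^+ k) * convol u v k) m
   - delay (delay (fun k => (1 - q ^+ k) * convol u v k)) m.
  (* Split 1 - q^m = (1 - q^j) + q^j (1 - q^(m-j)), so that each functional equation applies to one
     factor. *)
  transitivity (convol (fun j => (1 - q ^+ j) * u j) v m +
     convol (fun j => q ^+ j * u j) (fun j => (1 - q ^+ j) * v j) m).
    rewrite /convol mulr_sumr -big_split /=; apply: eq_bigr => j _.
    rewrite -[in q ^+ m](@subnKC j m) -1?ltnS // exprD; ring.
  have -> : (fun j => (1 - q ^+ j) * u j) =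
      (fun j => 2 * y * delay u j + -1 * delay (delay u) j).
    by apply/funext => j; exact: hermite_coef_rec.
  have -> : (fun j => (1 - q ^+ j) * v j) =
      (fun j => - (2 * y) * delay (fun n => q ^+ n * v n) j
                + 1 * delay (delay (fun n => q ^+ n * v n)) j).
    by apply/funext => j; rewrite mul1r; exact: bpol_coef_rec.
  rewrite convol_linl (convolC (fun j => q ^+ j * u j)) convol_linl.
  rewrite !convol_delayl !(convolC _ (fun j => q ^+ j * u j)).
  case: m => [|[|m]] /=; rewrite ?convol_scale; ring.
have e0 m : (1 - q ^+ m) * convol u v m = 0.
  elim/ltn_ind: m => m IH; rewrite rec.
  case: m IH => [|[|m]] IH /=; rewrite ?(IH m) ?(IH m.+1) ?IH //; ring.
case: n => [|n] /=.
  by rewrite /convol big_ord1 /u /v bpol0 qHermite0 qpoch0 divr1 mulr1.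
by have /eqP := e0 n.+1; rewrite mulf_eq0 (negPf (q_neq1 n)) => /eqP.
Qed.

End NotRootOfUnity.
End Algebra.

(** * Subexponential sequences and the power series they define *)

Section Subexponential.
Variable R : realType.
Implicit Types (u v z a : nat -> R) (s t q r C l : R).

(** Equivalently, the power series with coefficients [u] has radius of convergence at least 1. *)
Definition subexp u := forall s, 1 < s -> exists C, forall n, `|u n| <= C * s ^+ n.

Lemma exprn_eventually_le q e : `|q| < 1 -> 0 < e ->
  exists N, forall n, (N <= n)%N -> `|q| ^+ n <= e.
Proof.
move=> q1 e0; have /cvgrPdist_le /(_ e e0) [N _ HN] := cvg_expr q1.
by exists N => n Nn; have := HN n Nn; rewrite sub0r normrN normrX.
Qed.

Lemma ratio_bound z s N : (forall n, 0 <= z n) -> 1 <= s ->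
  (forall n, (N <= n)%N -> z n.+1 <= s * z n) ->
  exists C, forall n, z n <= C * s ^+ n.
Proof.
move=> z0 s1 Hz; exists (\sum_(i < N.+1) z i).
set C := \sum_(i < N.+1) z i.
have C0 : 0 <= C by apply: sumr_ge0.
have small n : (n <= N)%N -> z n <= C * s ^+ n.
  move=> nN; apply: (@le_trans _ _ C); last by rewrite ler_peMr // exprn_ege1.
  rewrite /C (bigD1 (Ordinal (nN : (n < N.+1)%N))) //= lerDl.
  exact: sumr_ge0.
elim=> [|n IH]; first exact: small.
have [nN|nN] := leqP N n; last exact: small.
apply: (le_trans (Hz n nN)); rewrite exprS mulrCA ler_wpM2l //.
exact: le_trans s1.
Qed.

Lemma subexp_ratio z : (forall n, 0 <= z n) ->
  (forall s, 1 < s -> exists N, forall n, (N <= n)%N -> z n.+1 <= s * z n) ->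
  subexp z.
Proof.
move=> z0 Hz s s1; have [N HN] := Hz s s1.
have [C HC] := ratio_bound z0 (ltW s1) HN.
by exists C => n; rewrite ger0_norm.
Qed.

Lemma subexp_le u v : (forall n, `|u n| <= `|v n|) -> subexp v -> subexp u.
Proof.
by move=> uv Hv s /Hv[C HC]; exists C => n; apply: le_trans (uv n) (HC n).
Qed.

Lemma subexpM u v : subexp u -> subexp v -> subexp (fun n => u n * v n).
Proof.
move=> Hu Hv s s1; pose t := Num.sqrt s.
have t1 : 1 < t by rewrite -sqrtr1 ltr_sqrt // (lt_trans ltr01).
have [C HC] := Hu t t1; have [D HD] := Hv t t1; exists (C * D) => n.
have -> : s = t * t by rewrite -expr2 sqr_sqrtr // ltW // (lt_trans ltr01).
rewrite normrM exprMn mulrACA; exact: ler_pM.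
Qed.

Lemma subexp_add u m : subexp u -> subexp (fun n => u (n + m)%N).
Proof.
move=> Hu s s1; have [C HC] := Hu s s1; exists (C * s ^+ m) => n.
by rewrite -mulrA -exprD addnC.
Qed.

Lemma subexp_succ : subexp (fun n => n.+1%:R).
Proof.
apply: subexp_ratio => // s s1.
(* The ratio (n+2)/(n+1) is at most s as soon as 1/(n+1) <= s - 1. *)
pose N := Num.trunc (s - 1)^-1.
exists N => n Nn; have s10 : 0 < s - 1 by rewrite subr_gt0.
have : (s - 1)^-1 < N.+1%:R by apply: truncnS_gt.
rewrite -[_^-1]mul1r ltr_pdivrMr // => h.
have h2 : N.+1%:R <= n.+1%:R :> R by rewrite ler_nat.
rewrite -natr1; nra.
Qed.

(** The cube leaves room for three subexponential losses in [convol_psum_cvg]: two from the factors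
    of a double series, one from counting terms. *)
Lemma exists_expr3_lt1 t : 0 <= t -> t < 1 -> exists2 s, 1 < s & s ^+ 3 * t < 1.
Proof.
move=> t0 t1; exists (1 + (1 - t) / 8%:R); first by lra.
set e := (1 - t) / 8%:R.
have e0 : 0 < e by rewrite /e; lra.
have e1 : e <= 1 by rewrite /e; lra.
have h : (1 + e) ^+ 3 <= 1 + 7%:R * e.
  have -> : (1 + e) ^+ 3 = 1 + 3%:R * e + 3%:R * (e * e) + e * (e * e) by ring.
  nra.
have : (1 + e) ^+ 3 * t <= (1 + 7%:R * e) * t by rewrite ler_wpM2r.
move=> h2; apply: le_lt_trans h2 _; rewrite /e; nra.
Qed.

Lemma subexp_dominated u t : subexp u -> `|t| < 1 ->
  exists C r, [/\ 0 <= r, r < 1 & forall n, `|u n * t ^+ n| <= C * r ^+ n].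
Proof.
move=> Hu t1; have [s s1 hs] := exists_expr3_lt1 (normr_ge0 t) t1.
have [C HC] := Hu s s1; exists C, (s * `|t|).
have s0 : 0 < s by apply: lt_trans s1.
split; first by rewrite mulr_ge0 // ltW.
- apply: le_lt_trans hs; rewrite ler_wpM2r // exprS ler_peMr ?(ltW s0) //.
  by rewrite exprn_ege1 // ltW.
- by move=> n; rewrite normrM normrX exprMn mulrA ler_wpM2r // exprn_ge0.
Qed.

Lemma cvg_geometric_dist a l C r : 0 <= r -> r < 1 ->
  (forall n, `|l - a n| <= C * r ^+ n) -> a @ \oo --> l.
Proof.
move=> r0 r1 H; apply/cvgrPdist_le => e e0.
have /cvgrPdist_le /(_ e e0) [N _ HN] : geometric C r @ \oo --> 0.
  by apply: cvg_geometric; rewrite ger0_norm.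
exists N => // n Nn; apply: le_trans (H n) _.
have := HN n Nn; rewrite /= sub0r normrN; apply: le_trans; exact: ler_norm.
Qed.

Lemma series_tail_le a l C r M : series a @ \oo --> l -> 0 <= r -> r < 1 ->
  (forall i, `|a i| <= C * r ^+ i) -> `|l - series a M| <= C * r ^+ M / (1 - r).
Proof.
move=> al r0 r1 Ha.
have r10 : 0 < 1 - r by rewrite subr_gt0.
have C0 : 0 <= C by have := Ha 0%N; rewrite expr0 mulr1; apply: le_trans.
have part k : `|series a (M + k)%N - series a M|
    <= C * r ^+ M / (1 - r) * (1 - r ^+ k).
  elim: k => [|k IH]; first by rewrite addn0 !subrr normr0 mulr0.
  rewrite addnS /series /= big_nat_recr //= addrAC.
  apply: le_trans (ler_normD _ _) _; apply: le_trans (lerD IH (Ha _)) _.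
  rewrite exprD exprS le_eqVlt; apply/orP; left; apply/eqP.
  by field; rewrite gt_eqF.
have cv : (fun N => `|series a N - series a M|) @ \oo --> `|l - series a M|.
  by apply: cvg_norm; apply: cvgB => //; exact: cvg_cst.
apply: (@cvgr_to_le _ _ _ _ _ _ _ cv); exists M => // N /= MN.
rewrite -(subnKC MN); apply: le_trans (part _) _.
rewrite ler_piMr ?lerBlDr ?lerDl ?exprn_ge0 //.
by rewrite divr_ge0 ?mulr_ge0 ?exprn_ge0 // ltW.
Qed.

Definition powseries u t := series (fun n => u n * t ^+ n).

Lemma powseriesS u t n : powseries u t n.+1 = powseries u t n + u n * t ^+ n.
Proof. by rewrite /powseries /series /= big_nat_recr. Qed.

Definition psum u t : R := limn (powseries u t).

Lemma cvg_psum u t : subexp u -> `|t| < 1 -> powseries u t @ \oo --> psum u t.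
Proof.
move=> Hu t1; have [C [r [r0 r1 H]]] := subexp_dominated Hu t1.
apply: normed_cvg; apply: (series_le_cvg _ _ H) => [n||].
- exact: normr_ge0.
- move=> n; apply: le_trans (H n); exact: normr_ge0.
- by apply: (@is_cvg_geometric_series _ C); rewrite ger0_norm.
Qed.

Lemma powseries_lin u v t l1 l2 (x y : R) :
  powseries u t @ \oo --> l1 -> powseries v t @ \oo --> l2 ->
  powseries (fun n => x * u n + y * v n) t @ \oo --> x * l1 + y * l2.
Proof.
move=> H1 H2.
have -> : powseries (fun n => x * u n + y * v n) t =
    (fun n => x * powseries u t n + y * powseries v t n).
  apply/funext => n; rewrite /powseries /series /= !mulr_sumr -big_split /=.
  by apply: eq_bigr => i _; ring.
by apply: cvgD; apply: cvgMl_tmp.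
Qed.

Lemma powseries_delay u t l :
  powseries u t @ \oo --> l -> powseries (delay u) t @ \oo --> t * l.
Proof.
move=> H; rewrite -cvg_shiftS.
have -> : (fun n => powseries (delay u) t n.+1) = (fun n => t * powseries u t n).
  apply/funext => n; rewrite /powseries /series /= big_nat_recl //= mul0r add0r.
  by rewrite mulr_sumr; apply: eq_bigr => i _; rewrite exprS; ring.
exact: cvgMl_tmp.
Qed.

Lemma powseries_expn u q t :
  powseries (fun n => q ^+ n * u n) t = powseries u (t * q).
Proof.
by rewrite /powseries; congr (series _); apply/funext => n; rewrite exprMn; ring.
Qed.

(** Turns a coefficient identity into a functional equation between sums. *)
Lemma powseries_unique u v t l1 l2 : powseries u t @ \oo --> l1 ->
  powseries v t @ \oo --> l2 -> u =1 v -> l1 = l2.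
Proof.
move=> H1 H2 /funext uv; rewrite uv in H1.
by apply: cvg_unique H1 H2; exact: Rhausdorff.
Qed.

(** Continuity of the sum at 0 along t q^n, which gives the limit of an iterated q-difference
    equation. *)
Lemma psum_expn_cvg u q t : subexp u -> `|t| < 1 -> `|q| < 1 ->
  (fun n => psum u (t * q ^+ n)) @ \oo --> u 0%N.
Proof.
move=> Hu t1 q1; have [C [r [r0 r1 H]]] := subexp_dominated Hu t1.
have C0 : 0 <= C by have := H 0%N; rewrite !expr0 !mulr1; apply: le_trans.
apply: (@cvg_geometric_dist _ _ (C / (1 - r)) `|q|) => // n.
have qn1 : `|q| ^+ n <= 1 by rewrite exprn_ile1 // ltW.
have tq1 : `|t * q ^+ n| < 1.
  by rewrite normrM normrX (le_lt_trans _ t1) // ler_piMr.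
have qr1 : r * `|q| ^+ n <= r by rewrite ler_piMr.
have qr0 : 0 <= r * `|q| ^+ n by rewrite mulr_ge0 // exprn_ge0.
(* The tail is cut at order 1, where the partial sum is exactly [u 0]. *)
have := @series_tail_le _ _ C (r * `|q| ^+ n) 1 (cvg_psum Hu tq1) qr0
  (le_lt_trans qr1 r1).
rewrite /series /= big_nat1 expr0 mulr1 distrC => h.
apply: le_trans (h _) _.
  move=> i; rewrite !exprMn mulrA !normrM mulrA ler_pM //.
    by rewrite -normrM.
  by rewrite !normrX.
rewrite expr1 -!mulrA ler_wpM2l // mulrA.
rewrite ler_pdivrMr ?subr_gt0 ?(le_lt_trans qr1) //.
rewrite [leRHS]mulrC mulrA [leRHS]mulrC mulrA [r * _]mulrC.
rewrite -mulrA ler_wpM2l ?exprn_ge0 // ler_pdivlMr ?subr_gt0 //.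
nra.
Qed.

Lemma convol_psum_cvg (U V X A : nat -> R) t :
  subexp U -> subexp V -> subexp X -> `|t| < 1 ->
  (forall j, powseries (fun i => V i * X (i + j)%N) t @ \oo --> A j) ->
  (fun N => powseries (fun j => U j * A j) t N
            - powseries (fun n => X n * convol V U n) t N) @ \oo --> 0.
Proof.
move=> HU HV HX t1 HA.
have [s s1 hs] := exists_expr3_lt1 (normr_ge0 t) t1.
have s0 : 0 < s by apply: lt_trans s1.
have [CU HCU] := HU s s1; have [CV HCV] := HV s s1; have [CX HCX] := HX s s1.
(* One factor s is kept out of [r] to absorb the number N of tails; this is why s r < 1 is
   required. *)
have [D HD] := subexp_succ s1.
pose r := s ^+ 2 * `|t|.
have r0 : 0 <= r by rewrite mulr_ge0 // exprn_ge0 // ltW.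
have sr1 : s * r < 1 by rewrite /r mulrA -exprS.
have r1 : r < 1 by apply: le_lt_trans sr1; rewrite ler_peMl // ltW.
pose C := CU * CV * CX.
have C0 : 0 <= C.
  have h (u : nat -> R) c : (forall n, `|u n| <= c * s ^+ n) -> 0 <= c.
    by move/(_ 0%N); rewrite expr0 mulr1; apply: le_trans.
  by rewrite !mulr_ge0 // (h _ _ HCU, h _ _ HCV, h _ _ HCX).
have bound j i :
    `|U j * t ^+ j * (V i * X (i + j)%N * t ^+ i)| <= C * r ^+ j * r ^+ i.
  have -> : C * r ^+ j * r ^+ i = (CU * s ^+ j) * `|t| ^+ j *
      ((CV * s ^+ i) * (CX * s ^+ (i + j)) * `|t| ^+ i).
    by rewrite /C /r expr2 !exprMn exprD; ring.
  by rewrite !normrM !normrX !ler_pM // ?mulr_ge0 // exprn_ge0.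
(* The triangle, summed by diagonals on the left, is regrouped by columns of fixed j. *)
have split_sum N : powseries (fun n => X n * convol V U n) t N =
    \sum_(j < N) U j * t ^+ j *
      powseries (fun i => V i * X (i + j)%N) t (N - j)%N.
  elim: N => [|N IH]; first by rewrite /powseries /series /= big_geq // big_ord0.
  rewrite powseriesS IH big_ord_recr /= subSnn powseriesS.
  rewrite [powseries _ _ 0]/series /= big_geq // add0r add0n expr0 mulr1.
  rewrite convolC /convol big_ord_recr /= subnn.
  have -> : \sum_(j < N) U j * t ^+ j *
      powseries (fun i => V i * X (i + j)%N) t (N.+1 - j)%N =
     \sum_(j < N) (U j * t ^+ j * powseries (fun i => V i * X (i + j)%N) t (N - j)%N
       + X N * t ^+ N * (U j * V (N - j)%N)).
    apply: eq_bigr => j _; rewrite subSn 1?ltnW // powseriesS subnK 1?ltnW //.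
    have -> : t ^+ N = t ^+ j * t ^+ (N - j) by rewrite -exprD subnKC // ltnW.
    ring.
  by rewrite big_split /= -mulr_sumr; ring.
apply: (@cvg_geometric_dist _ _ (D * (C / (1 - r))) (s * r)) => //.
  by rewrite mulr_ge0 // ltW.
move=> N; rewrite sub0r normrN split_sum.
rewrite /powseries {1}/series /= big_mkord -sumrB.
apply: le_trans (ler_norm_sum _ _ _) _.
apply: (@le_trans _ _ (\sum_(j < N) C * r ^+ N / (1 - r))).
  apply: ler_sum => j _.
  set f := fun i => V i * X (i + j)%N * t ^+ i.
  have Ef n : series (fun i => U j * t ^+ j * f i) n = U j * t ^+ j * series f n.
    by rewrite /series /= mulr_sumr.
  have cvf : series (fun i => U j * t ^+ j * f i) @ \oo --> U j * t ^+ j * A j.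
    by rewrite (funext Ef); apply: cvgMl_tmp; exact: HA.
  have := series_tail_le (N - j) cvf r0 r1 (bound j).
  by rewrite Ef -[C * _ * _]mulrA -exprD subnKC 1?ltnW // mulrAC.
rewrite sumr_const card_ord -[leLHS]mulr_natl.
have -> : D * (C / (1 - r)) * (s * r) ^+ N = D * s ^+ N * (C * r ^+ N / (1 - r)).
  by rewrite exprMn; ring.
rewrite ler_wpM2r //.
  by rewrite divr_ge0 ?(mulr_ge0 C0) ?exprn_ge0 ?subr_ge0 // ltW.
apply: le_trans (le_trans (ler_norm _) (HD N)); by rewrite ler_nat.
Qed.

End Subexponential.

Arguments powseries_lin {R u v t l1 l2}.

(** * Subexponential growth of 1/(q)_n, h_n and b_n *)

Section Growth.
Variables (R : realType) (q : R).
Hypothesis q_lt1 : `|q| < 1.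

Lemma onesub_expr_neq0 k : 1 - q ^+ k.+1 != 0.
Proof.
rewrite subr_eq0; apply/eqP => h.
have : `|q| ^+ k.+1 < 1 by rewrite exprn_ilt1.
by rewrite -normrX -h normr1 ltxx.
Qed.

(** Consecutive terms have ratio 1/(1 - q^(n+1)), which tends to 1. *)
Lemma subexp_qpochV : subexp (fun n => (qpoch q q n)^-1).
Proof.
apply: (@subexp_le _ _ (fun n => `|(qpoch q q n)^-1|)) => [n|].
  by rewrite normr_id.
apply: subexp_ratio => [n|s s1]; first exact: normr_ge0.
have s0 : 0 < s by apply: lt_trans s1.
have e0 : 0 < 1 - s^-1 by rewrite subr_gt0 invf_lt1.
have [N HN] := exprn_eventually_le q_lt1 e0.
exists N => n Nn; rewrite qpochS -exprS invfM mulrC normrM ler_wpM2r //.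
have h : s^-1 <= `|1 - q ^+ n.+1|.
  have := HN n.+1 (leqW Nn); rewrite -normrX.
  have := lerB_dist 1 (q ^+ n.+1); rewrite normr1; lra.
rewrite normfV -[leRHS]invrK lef_pV2 // posrE ?invr_gt0 //.
by rewrite normr_gt0 onesub_expr_neq0.
Qed.

(* For x = cos theta, [e n] below is |h_{n+1} - exp(i theta) h_n|; the recurrence
   changes it by at most |q|^(n+1) |h_n|, because the unperturbed (q = 0) one
   multiplies h_{n+1} - exp(i theta) h_n by a number of modulus 1. *)
Lemma subexp_hermite x : `|x| <= 1 -> subexp (qHermite x q).
Proof.
move=> x1 s s1; pose h := qHermite x q.
pose e2 n := (h n.+1 - x * h n) ^+ 2 + (1 - x ^+ 2) * h n ^+ 2.
have xx : 0 <= 1 - x ^+ 2 by rewrite subr_ge0 -real_normK ?num_real // expr_le1.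
have e20 n : 0 <= e2 n by rewrite addr_ge0 ?sqr_ge0 // mulr_ge0 // sqr_ge0.
pose e n := Num.sqrt (e2 n).
have eK n : e n ^+ 2 = e2 n by rewrite sqr_sqrtr.
have le_e n (c : R) : c ^+ 2 <= e2 n -> `|c| <= e n.
  by move=> hc; rewrite -sqrtr_sqr ler_sqrt.
have stepH n : `|h n.+1| <= `|h n| + e n.
  have -> : h n.+1 = x * h n + (h n.+1 - x * h n) by ring.
  apply: le_trans (ler_normD _ _) _; apply: lerD.
    by rewrite normrM ler_piMl.
  by apply: le_e; rewrite lerDl mulr_ge0 // sqr_ge0.
have stepE n : e n.+1 <= e n + `|q| ^+ n.+1 * `|h n|.
  have eS0 : 0 <= e n.+1 by rewrite sqrtr_ge0.
  have en0 : 0 <= e n by rewrite sqrtr_ge0.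
  rewrite -normrX -normrM; set d := q ^+ n.+1 * h n.
  have E : e2 n.+1 = e2 n + 2 * d * (x * h n.+1 - h n) + d ^+ 2.
    by rewrite /e2 [h n.+2]qHermiteS -!/(h _) /d; ring.
  rewrite -ler_sqr ?nnegrE ?addr_ge0 // eK E sqrrD eK real_normK ?num_real //.
  (* [e2 n] is symmetric in h_n and h_{n+1}: it also equals (x h_{n+1} - h_n)^2 + (1 - x^2)
     h_{n+1}^2. *)
  have hc : `|x * h n.+1 - h n| <= e n.
    apply: le_e; rewrite /e2; set a := h n.+1; set b := h n.
    have : 0 <= (1 - x ^+ 2) * a ^+ 2 by rewrite mulr_ge0 // sqr_ge0.
    nra.
  rewrite lerD2r lerD2l -mulrA mulr2n.
  have : d * (x * h n.+1 - h n) <= `|d| * e n.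
    apply: le_trans (ler_norm _) _; rewrite normrM ler_wpM2l //.
  rewrite [e n * _]mulrC; lra.
have s10 : 0 < s - 1 by rewrite subr_gt0.
(* This weight makes |h_n| + K e_n grow by a factor at most s: e_n = (s - 1) K e_n, and the
   perturbation costs K (s - 1)^2 |h_n| = (s - 1) |h_n| once |q|^(n+1) <= (s - 1)^2. *)
pose K := (s - 1)^-1.
have K0 : 0 < K by rewrite invr_gt0.
have Ks : K * (s - 1) = 1 by rewrite mulVf // gt_eqF.
have e0 : 0 < (s - 1) ^+ 2 by rewrite exprn_gt0.
have [N HN] := exprn_eventually_le q_lt1 e0.
have [|||C HC] := @ratio_bound R (fun n => `|h n| + K * e n) s N.
- by move=> n; rewrite addr_ge0 // mulr_ge0 ?sqrtr_ge0 // ltW.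
- exact: ltW.
- move=> n Nn.
  have H1 := stepH n; have H2 := stepE n; have H3 := HN n.+1 (leqW Nn).
  have hn0 : 0 <= `|h n| by [].
  have : K * e n.+1 <= K * e n + (s - 1) * `|h n|.
    have -> : (s - 1) * `|h n| = K * ((s - 1) ^+ 2 * `|h n|).
      by rewrite expr2 !mulrA Ks mul1r.
    rewrite -mulrDr ler_wpM2l ?(ltW K0) //; apply: le_trans H2 _.
    by rewrite lerD2l ler_wpM2r.
  have : e n = K * e n * (s - 1) by rewrite mulrAC Ks mul1r.
  set a := K * e n; lra.
exists C => n; apply: le_trans (HC n); rewrite lerDl.
by rewrite mulr_ge0 ?sqrtr_ge0 // ltW.
Qed.

(** Both coefficients of the recurrence tend to 0, so eventually |b_{n+2}| <= (s - 1) |b_{n+1}| +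
    |b_n|, and |b_n| + |b_{n+1}| grows by a factor at most s. *)
Lemma subexp_bpol x : `|x| <= 1 -> subexp (bpol x q).
Proof.
move=> x1; pose b := bpol x q.
apply: (@subexp_le _ _ (fun n => `|b n| + `|b n.+1|)) => [n|].
  by rewrite [leRHS]ger0_norm ?addr_ge0 // lerDl.
apply: subexp_ratio => [n|s s1]; first by rewrite addr_ge0.
have s10 : 0 < (s - 1) / 2 by rewrite divr_gt0 // subr_gt0.
have h20 : 0 < 2^-1 :> R by rewrite invr_gt0.
have [N HN] := exprn_eventually_le q_lt1 s10.
have [M HM] := exprn_eventually_le q_lt1 h20.
exists (N + M)%N => n Nn.
have H1 : `|q| ^+ n.+1 <= (s - 1) / 2 by apply: HN; lia.
have H2 : `|q| ^+ n <= 2^-1 by apply: HM; lia.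
have q0 : 0 <= `|q| ^+ n by rewrite exprn_ge0.
have q0' : 0 <= `|q| ^+ n.+1 by rewrite exprn_ge0.
have q1' : `|q| ^+ n.+1 <= 1 by rewrite exprn_ile1 // ltW.
have : `|b n.+2| <= 2 * `|q| ^+ n.+1 * `|b n.+1| + `|q| ^+ n * 2 * `|b n|.
  rewrite /b bpolS; apply: le_trans (ler_normD _ _) _.
  rewrite !normrM normrN !normrM !normrX normr_nat; apply: lerD.
    by rewrite ler_wpM2r // ler_wpM2r // ler_piMr.
  rewrite ler_wpM2r // ler_wpM2l //.
  apply: le_trans (ler_normB _ _) _; rewrite normr1 normrX; lra.
have : `|q| ^+ n * `|b n| <= 2^-1 * `|b n| by rewrite ler_wpM2r.
have : `|q| ^+ n.+1 * `|b n.+1| <= (s - 1) / 2 * `|b n.+1| by rewrite ler_wpM2r.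
have : 0 <= (s - 1) * `|b n| by rewrite mulr_ge0 // subr_ge0 ltW.
lra.
Qed.

End Growth.

(** * The q-difference equations of the Euler and Mehler series *)

Section Mehler.
Variables (R : realType) (q : R).
Hypothesis q_lt1 : `|q| < 1.

Lemma normM_expr_lt1 (a : R) n : `|a| < 1 -> `|a * q ^+ n| < 1.
Proof.
move=> a1; rewrite normrM normrX (le_lt_trans _ a1) // ler_piMr //.
by rewrite exprn_ile1 // ltW.
Qed.

Lemma normM_lt1 (a : R) : `|a| < 1 -> `|a * q| < 1.
Proof. by move/(normM_expr_lt1 1). Qed.

(** Euler's series E(t) = sum_n t^n / (q)_n satisfies E(qt) = (1 - t) E(t), so (a)_n E(a) = E(a q^n)
    tends to 1. Hence E(a) is nonzero and (a)_n tends to 1/E(a). *)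
Lemma qpoch_cvg (a : R) : `|a| < 1 ->
  qpoch a q @ \oo --> qpoch_inf a q /\ qpoch_inf a q != 0.
Proof.
move=> a1; pose u n := (qpoch q q n)^-1.
have Hu : subexp u by exact: subexp_qpochV.
have step t : `|t| < 1 -> psum u (t * q) = (1 - t) * psum u t.
  move=> t1; have H := cvg_psum Hu t1.
  have H1 := cvg_psum Hu (normM_lt1 t1).
  have H2 := powseries_lin 1 (-1) H (powseries_delay H).
  rewrite -powseries_expn in H1.
  rewrite (powseries_unique H1 H2); first by ring.
  case=> [|n] /=; first by rewrite mul1r; ring.
  rewrite /u qpochS -exprS.
  have h1 := onesub_expr_neq0 q_lt1 n.
  have h2 := qpoch_neq0 (onesub_expr_neq0 q_lt1) n.
  by field; rewrite h1 h2.
have prod n : qpoch a q n * psum u a = psum u (a * q ^+ n).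
  elim: n => [|n IH]; first by rewrite qpoch0 mul1r expr0 mulr1.
  by rewrite qpochS mulrAC IH mulrC -step ?normM_expr_lt1 // exprSr mulrA.
have lim1 := psum_expn_cvg Hu a1 q_lt1.
rewrite /u qpoch0 invr1 -/u in lim1.
have e0 : psum u a != 0.
  apply/eqP => h; have /eqP : 0 = 1 :> R; last by rewrite eq_sym oner_eq0.
  have E : (fun n => psum u (a * q ^+ n)) = (fun=> 0).
    by apply/funext => n; rewrite -prod h mulr0.
  rewrite E in lim1; apply: (cvg_unique _ _ lim1); [exact: Rhausdorff|exact: cvg_cst].
have cv : qpoch a q @ \oo --> (psum u a)^-1.
  have -> : qpoch a q = (fun n => psum u (a * q ^+ n) * (psum u a)^-1).
    by apply/funext => n; rewrite -prod mulfK.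
  by rewrite -[X in _ --> X]mul1r; exact: cvgMr_tmp.
by rewrite /qpoch_inf (cvg_lim (@Rhausdorff R) cv) invr_eq0.
Qed.

Definition mehler_coef (x y : R) n := qHermite x q n * qHermite y q n / qpoch q q n.

(* Coefficientwise w(x,y|t) F(t) = (1 - t^2)(1 - q t^2) F(qt), nested so that both
   sides are instances of powseries_lin. *)
Lemma mehler_coef_rec x y n (c := mehler_coef x y)
    (d := fun n => q ^+ n * mehler_coef x y n) :
  1 * (1 * (1 * (1 * c n + - (4 * x * y) * delay c n)
    + (4 * (x ^+ 2 + y ^+ 2) - 2) * delay (delay c) n)
    + - (4 * x * y) * delay (delay (delay c)) n)
    + 1 * delay (delay (delay (delay c))) n
  = 1 * (1 * d n + - (1 + q) * delay (delay d) n)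
    + q * delay (delay (delay (delay d))) n.
Proof.
have nz := onesub_expr_neq0 q_lt1.
have n1 : 1 - q != 0 by have := nz 0%N; rewrite expr1.
have n2 := nz 1%N; have n3 := nz 2%N.
have q0 := qpoch_neq0 nz.
rewrite /d /c /mehler_coef; case: n => [|[|[|[|n]]]] /=.
- rewrite !qHermite0 qpoch0; by field.
- rewrite !qHermite1 !qHermite0 !qpochS !qpoch0 expr1.
  by field; rewrite ?n1.
- rewrite !qHermiteS !qHermite1 !qHermite0 !qpochS !qpoch0 -?exprS.
  by field; rewrite ?n1 ?n2.
- rewrite !qHermiteS !qHermite1 !qHermite0 !qpochS !qpoch0 -?exprS.
  by field; rewrite ?n1 ?n2 ?n3.
have h1 := nz n; have h2 := nz n.+1; have h3 := nz n.+2; have h4 := nz n.+3.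
have h0 := q0 n.
rewrite !qHermiteS !qpochS -!exprS.
move: h0 h1 h2 h3 h4; rewrite !exprS.
move: (q ^+ n) (qpoch q q n) (qHermite x q n) (qHermite y q n) => Q P a b.
move: (qHermite x q n.+1) (qHermite y q n.+1) => a1 b1 h0 h1 h2 h3 h4.
by field; rewrite ?h0 ?h1 ?h2 ?h3 ?h4.
Qed.

End Mehler.

(** * Mehler's formula, Carlitz's sums and the reciprocal expansion *)

Section MehlerSum.
Variables (R : realType) (q rho x y : R).
Hypotheses (q_lt1 : `|q| < 1) (rho_lt1 : `|rho| < 1).
Hypotheses (x_le1 : `|x| <= 1) (y_le1 : `|y| <= 1).

Let c := mehler_coef q x y.
Let F := psum c.

Let rho2_lt1 : `|rho ^+ 2| < 1.
Proof. by rewrite normrX exprn_ilt1. Qed.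

Let q_unity := onesub_expr_neq0 q_lt1.

Let subexp_c : subexp c.
Proof.
apply: subexpM; last exact: subexp_qpochV.
by apply: subexpM; exact: subexp_hermite.
Qed.

Lemma mehler_step t : `|t| < 1 ->
  wfun x y t * F t = (1 - t ^+ 2) * (1 - t ^+ 2 * q) * F (t * q).
Proof.
move=> t1; have H0 := cvg_psum subexp_c t1.
have K0 := cvg_psum subexp_c (normM_lt1 q_lt1 t1).
rewrite -powseries_expn in K0.
have H1 := powseries_delay H0; have H2 := powseries_delay H1.
have H3 := powseries_delay H2; have H4 := powseries_delay H3.
have K2 := powseries_delay (powseries_delay K0).
have K4 := powseries_delay (powseries_delay K2).
have HL := powseries_lin 1 1 (powseries_lin 1 (- (4 * x * y)) (powseries_lin 1
  (4 * (x ^+ 2 + y ^+ 2) - 2) (powseries_lin 1 (- (4 * x * y)) H0 H1) H2) H3) H4.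
have HR := powseries_lin 1 q (powseries_lin 1 (- (1 + q)) K0 K2) K4.
have E := powseries_unique HL HR (mehler_coef_rec q_lt1 x y).
by apply: etrans (etrans _ E) _; rewrite /F /wfun; ring.
Qed.

(** At t = rho q^n, (1 - t^2)(1 - q t^2) supplies the factors of index 2n and 2n + 1 of (rho^2)_oo,
    hence the doubled index. *)
Lemma mehler_prod n : \prod_(j < n) wfun x y (rho * q ^+ j) * F rho =
  qpoch (rho ^+ 2) q n.*2 * F (rho * q ^+ n).
Proof.
elim: n => [|n IH]; first by rewrite big_ord0 qpoch0 expr0 mulr1.
rewrite big_ord_recr /= mulrAC IH -mulrA [F _ * _]mulrC.
rewrite mehler_step ?normM_expr_lt1 // doubleS !qpochS [q ^+ n.+1]exprSr.
rewrite [rho * (_ * q)]mulrA.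
have -> : (rho * q ^+ n) ^+ 2 = rho ^+ 2 * q ^+ n.*2.
  by rewrite exprMn -exprM muln2.
by rewrite [q ^+ _.*2.+1]exprSr [rho ^+ 2 * (_ * _)]mulrA; ring.
Qed.

Let F_cvg : (fun n => F (rho * q ^+ n)) @ \oo --> (1 : R).
Proof.
have := psum_expn_cvg subexp_c rho_lt1 q_lt1.
by rewrite /c /mehler_coef !qHermite0 qpoch0 mulr1 divr1.
Qed.

Let qpoch_double_cvg :
  (fun n => qpoch (rho ^+ 2) q n.*2 * F (rho * q ^+ n)) @ \oo
    --> qpoch_inf (rho ^+ 2) q.
Proof.
rewrite -[X in _ --> X]mulr1; apply: cvgM => //.
have [cv _] := qpoch_cvg q_lt1 rho2_lt1.
apply: (cvg_comp (fun n => n.*2) (qpoch (rho ^+ 2) q)) cv.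
move=> A [N _ HN]; exists N => // n /= Nn; apply: HN => /=.
by rewrite (leq_trans Nn) // -addnn leq_addr.
Qed.

(** Otherwise the right side of [mehler_prod] would vanish for all n, whereas its limit (rho^2)_oo
    is nonzero. *)
Lemma mehler_sum_neq0 : F rho != 0.
Proof.
apply/eqP => h; have [_ /eqP] := qpoch_cvg q_lt1 rho2_lt1; apply.
have cv := qpoch_double_cvg.
have E : (fun n => qpoch (rho ^+ 2) q n.*2 * F (rho * q ^+ n)) = (fun=> 0).
  by apply/funext => n; rewrite -mehler_prod h mulr0.
rewrite E in cv; apply: (cvg_unique _ cv); [exact: Rhausdorff|exact: cvg_cst].
Qed.

Lemma wprod_infE : wprod_inf x y rho q = qpoch_inf (rho ^+ 2) q / F rho.
Proof.
apply: cvg_lim; first exact: Rhausdorff.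
have -> : (fun n => \prod_(j < n) wfun x y (rho * q ^+ j)) =
    (fun n => qpoch (rho ^+ 2) q n.*2 * F (rho * q ^+ n) / F rho).
  by apply/funext => n; rewrite -mehler_prod mulfK // mehler_sum_neq0.
exact: cvgMr_tmp.
Qed.

Lemma mehler : series (fun j => rho ^+ j / qpoch q q j * qHermite x q j *
    qHermite y q j) @ \oo --> qpoch_inf (rho ^+ 2) q / wprod_inf x y rho q.
Proof.
have [_ p0] := qpoch_cvg q_lt1 rho2_lt1.
rewrite wprod_infE invf_div mulrC divfK //.
rewrite [X in series X](_ : _ = fun n => c n * rho ^+ n); first exact: cvg_psum.
by apply/funext => n; rewrite /c /mehler_coef; ring.
Qed.

Let V i := qHermite y q i / qpoch q q i.
Let A m := psum (fun i => V i * qHermite x q (i + m)%N) rho.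

Let A_cvg m : powseries (fun i => V i * qHermite x q (i + m)%N) rho @ \oo --> A m.
Proof.
apply: cvg_psum => //; apply: subexpM.
  by apply: subexpM; [exact: subexp_hermite|exact: subexp_qpochV].
by apply: subexp_add; exact: subexp_hermite.
Qed.

(** Expands h_{i+1}(y) by its recurrence; since (1 - q^i)/(q)_i = 1/(q)_{i-1}, the second term is a
    delayed [A m.+1]. These sums arise when the recurrence is applied in x. *)
Let D_cvg m :
  powseries (fun i => qHermite y q i.+1 / qpoch q q i * qHermite x q (i + m)%N) rho
    @ \oo --> 2 * y * A m - rho * A m.+1.
Proof.
rewrite -mulN1r [X in powseries X](_ : _ = fun n => 2 * y * (V n * qHermite x q (n + m)%N)
  + -1 * delay (fun i => V i * qHermite x q (i + m.+1)%N) n).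
  exact: powseries_lin (@A_cvg m) (powseries_delay (@A_cvg m.+1)).
apply/funext => -[|i] /=; rewrite /V.
  by rewrite qHermite1 qHermite0; ring.
rewrite qHermiteS qpochS -exprS addSnnS.
have h1 := q_unity i; have h2 := qpoch_neq0 q_unity i.
by field; rewrite h1 h2.
Qed.

Let A1 : (1 - rho ^+ 2) * A 1%N = 2 * (x - rho * y) * A 0%N.
Proof.
have H := powseries_lin (2 * x) (-1) (@A_cvg 0) (powseries_delay (@D_cvg 0)).
have E := powseries_unique (@A_cvg 1) H.
rewrite mulrBl mul1r {1}E; first by ring.
case=> [|i] /=; rewrite /V ?addn0 ?addn1.
  by rewrite qHermite1 !qHermite0; ring.
rewrite [qHermite x q i.+2]qHermiteS qpochS -exprS.
have h1 := q_unity i; have h2 := qpoch_neq0 q_unity i.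
by field; rewrite h1 h2.
Qed.

(** Expand h_{i+m+2}(x) with 1 - q^(i+m+1) = (1 - q^(m+1)) + q^(m+1) (1 - q^i). The last part
    cancels against (q)_i and gives the delayed sum of [D_cvg], whose own [A m.+2] term moves to the
    left. *)
Let AS m : (1 - rho ^+ 2 * q ^+ m.+1) * A m.+2 =
  2 * (x - rho * y * q ^+ m.+1) * A m.+1 - (1 - q ^+ m.+1) * A m.
Proof.
have H := powseries_lin 1 (- q ^+ m.+1) (powseries_lin (2 * x) (- (1 - q ^+ m.+1))
  (@A_cvg m.+1) (@A_cvg m)) (powseries_delay (@D_cvg m.+1)).
have E := powseries_unique (@A_cvg m.+2) H.
rewrite mulrBl mul1r {1}E; first by ring.
case=> [|i] /=; rewrite /V.
  by rewrite !add0n qHermiteS; ring.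
rewrite !addnS !addSn [qHermite x q _.+3]qHermiteS qpochS -exprS.
have -> : q ^+ (i + m).+2 = q ^+ i.+1 * q ^+ m.+1 by rewrite -exprD addnS addSn.
have h1 := q_unity i; have h2 := qpoch_neq0 q_unity i.
by field; rewrite h1 h2.
Qed.

Let qpoch_rho_neq0 m : 1 - rho ^+ 2 * q ^+ m != 0.
Proof.
rewrite subr_eq0; apply/eqP => h.
by have := normM_expr_lt1 q_lt1 m rho2_lt1; rewrite -h normr1 ltxx.
Qed.

Let A0 : A 0 = F rho.
Proof.
rewrite /A /F /psum; congr (limn (powseries _ _)); apply/funext => n.
by rewrite addn0 /V /c /mehler_coef; ring.
Qed.

(** After multiplication by (rho^2)_m, [AS] becomes the recurrence of p_m, with initial values given
    by [A0] and [A1]. *)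
Lemma carlitz m : A m * qpoch (rho ^+ 2) q m = pASC x y rho q m * F rho.
Proof.
rewrite -A0.
suff [] : A m * qpoch (rho ^+ 2) q m = pASC x y rho q m * A 0 /\
  A m.+1 * qpoch (rho ^+ 2) q m.+1 = pASC x y rho q m.+1 * A 0 by [].
elim: m => [|m [IH1 IH2]].
  split; first by rewrite qpoch0 mulrC.
  by rewrite qpochS qpoch0 expr0 mulr1 mul1r mulrC A1.
split=> //; rewrite qpochS pASCS.
transitivity (qpoch (rho ^+ 2) q m.+1 * (2 * (x - rho * y * q ^+ m.+1) * A m.+1
  - (1 - q ^+ m.+1) * A m)); first by rewrite -AS; ring.
transitivity (2 * (x - rho * y * q ^+ m.+1) * (pASC x y rho q m.+1 * A 0) -
  (1 - rho ^+ 2 * q ^+ m) * (1 - q ^+ m.+1) * (pASC x y rho q m * A 0)).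
  by rewrite -IH1 -IH2 qpochS; ring.
ring.
Qed.

Let U j := bpol y q j / qpoch q q j.

Lemma asc_sum_cvg : powseries (fun j => U j * A j) rho @ \oo --> (1 : R).
Proof.
have HU : subexp U.
  by apply: subexpM; [exact: subexp_bpol|exact: subexp_qpochV].
have HV : subexp V.
  by apply: subexpM; [exact: subexp_hermite|exact: subexp_qpochV].
have := convol_psum_cvg HU HV (subexp_hermite q_lt1 x_le1) rho_lt1 A_cvg.
(* The shift discards the empty partial sum, which is 0; from order 1 on the diagonal sums are
   exactly 1. *)
move=> H; rewrite -cvg_shiftS; apply/subr_cvg0.
move: H; rewrite -cvg_shiftS /=.
have one n : powseries (fun n => qHermite x q n * convol V U n) rho n.+1 = 1.
  elim: n => [|n IH]; rewrite powseriesS.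
    rewrite /powseries /series /= big_geq // convol_hermite_bpol //.
    by rewrite add0r expr0 qHermite0 !mulr1.
  by rewrite IH convol_hermite_bpol // mulr0 mul0r addr0.
by rewrite (funext (fun n => congr1 (fun z => _ - z) (one n))).
Qed.

Lemma mehler_inverse : series (fun j => rho ^+ j /
    (qpoch q q j * qpoch (rho ^+ 2) q j) * bpol y q j * pASC x y rho q j) @ \oo
  --> wprod_inf x y rho q / qpoch_inf (rho ^+ 2) q.
Proof.
have [_ p0] := qpoch_cvg q_lt1 rho2_lt1; have F0 := mehler_sum_neq0.
rewrite wprod_infE mulrAC divff // mul1r.
have -> : (fun j => rho ^+ j / (qpoch q q j * qpoch (rho ^+ 2) q j) *
      bpol y q j * pASC x y rho q j) =
    (fun j => (F rho)^-1 * (U j * A j * rho ^+ j)).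
  apply/funext => j; rewrite /U.
  have P0 : qpoch (rho ^+ 2) q j != 0 by apply/prodf_neq0 => i _.
  have -> : A j = pASC x y rho q j * F rho / qpoch (rho ^+ 2) q j.
    by rewrite -carlitz mulfK.
  have h2 := qpoch_neq0 q_unity j.
  by field; rewrite F0 P0 h2.
have -> : series (fun j => (F rho)^-1 * (U j * A j * rho ^+ j)) =
    (fun n => (F rho)^-1 * powseries (fun j => U j * A j) rho n).
  by apply/funext => n; rewrite /powseries /series /= mulr_sumr.
rewrite -[X in _ --> X]mulr1; apply: cvgMl_tmp; exact: asc_sum_cvg.
Qed.

End MehlerSum.

Theorem theorem7 (R : realType) (q : R) (hq : `|q| < 1) :
  (forall (n : nat) (y : R[i]), (1 <= n)%N ->
     0 = \sum_(0 <= j < n.+1)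
           qbinom (q%:C)%C n j * qHermite y (q%:C)%C j
           * bpol y (q%:C)%C (n - j))
  /\
  (forall rho x y : R, `|rho| < 1 -> `|x| <= 1 -> `|y| <= 1 ->
     (series (fun j : nat =>
                rho ^+ j / qpoch q q j * qHermite x q j * qHermite y q j)
        @ \oo --> qpoch_inf (rho ^+ 2) q / wprod_inf x y rho q)
     /\
     (series (fun j : nat =>
                rho ^+ j / (qpoch q q j * qpoch (rho ^+ 2) q j)
                * bpol y q j * pASC x y rho q j)
        @ \oo --> wprod_inf x y rho q / qpoch_inf (rho ^+ 2) q)).
Proof.
split=> [n y n1|rho x y rho1 x1 y1]; last by split; [exact: mehler|exact: mehler_inverse].
have nz k : 1 - (q%:C)%C ^+ k.+1 != 0 :> R[i].
  by rewrite -rmorphXn -(rmorph1 (real_complex R)) -rmorphB fmorph_eq0 onesub_expr_neq0.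
(* The q-binomial sum is (q)_n times the n-th coefficient of phi psi, taken over [R[i]]. *)
transitivity (qpoch (q%:C)%C (q%:C)%C n *
  convol (fun n => qHermite y (q%:C)%C n / qpoch (q%:C)%C (q%:C)%C n)
    (fun n => bpol y (q%:C)%C n / qpoch (q%:C)%C (q%:C)%C n) n).
  by rewrite convol_hermite_bpol //; case: n n1 => // n _; rewrite mulr0.
rewrite /convol mulr_sumr big_mkord; apply: eq_bigr => j _.
have h1 := qpoch_neq0 nz j; have h2 := qpoch_neq0 nz (n - j).
by rewrite /qbinom; field; rewrite h1 h2.
Qed.
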